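(* Let $A$ be a countable commutative ring with unit (an enumeration $x_0, x_1, \ldots$ of its elements is given). Let $x \in A$ be an element which is not nilpotent. Then there is a radical and $\neg\neg$-stable prime ideal $\mathfrak{p} \subseteq A$ such that $x \notin \mathfrak{p}$.
   Context: The metatheory is constructive (minimal logic; no law of excluded middle and no form of the axiom of choice). The negation ``not $\varphi$'' (written $\neg\varphi$) means ``$\varphi \Rightarrow 1 = 0$ in $A$''; consequently $x \notin M$ means $x \in M \Rightarrow 1 = 0$ in $A$, and ``$x$ is not nilpotent'' means that if $x$ is nilpotent then $1 = 0$ in $A$. An ideal $\mathfrak{p} \subseteq A$ is prime if it is proper ($1 \notin \mathfrak{p}$) and for all $a, b \in A$, if $ab \in \mathfrak{p}$ and $a \notin \mathfrak{p}$, then $b \in \mathfrak{p}$. It is radical if for every $k \geq 0$ and $a \in A$, $a^k \in \mathfrak{p}$ implies $a \in \mathfrak{p}$. It is $\neg\neg$-stable if for every $a \in A$, $\neg\neg(a \in \mathfrak{p})$ implies $a \in \mathfrak{p}$. *)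

(* Defs.v *)
From Stdlib Require Import Ring_theory Setoid.

Set Implicit Arguments.
Unset Strict Implicit.

(** Rings are setoids: equality is an arbitrary congruence, not assumed to be
    decidable, and may be taken to be [@eq]. The trivial ring is allowed. *)
Record comRing : Type := ComRing {
  carrier :> Type;
  req : carrier -> carrier -> Prop;
  zero : carrier;
  one : carrier;
  add : carrier -> carrier -> carrier;
  mul : carrier -> carrier -> carrier;
  sub : carrier -> carrier -> carrier;
  opp : carrier -> carrier;
  req_equiv : Equivalence req;
  req_ext : ring_eq_ext add mul opp req;
  ring_ax : ring_theory zero one add mul sub opp req
}.

Arguments zero {c}.
Arguments one {c}.

Declare Scope cring_scope.
Delimit Scope cring_scope with cring.
Infix "==" := (@req _) (at level 70, no associativity) : cring_scope.
Infix "+" := (@add _) : cring_scope.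
Infix "*" := (@mul _) : cring_scope.
Notation "0" := zero : cring_scope.
Notation "1" := one : cring_scope.

Local Open Scope cring_scope.

Definition pow (A : comRing) (a : A) (k : nat) : A := Nat.iter k (mul a) 1.

Infix "^" := (@pow _) : cring_scope.

(** Negation relative to [A]: absurdity is [1 == 0] in [A], not [False], so in
    the trivial ring every proposition is negated. *)
Definition neg (A : comRing) (P : Prop) : Prop := P -> (1 : A) == 0.

Definition nilpotent (A : comRing) (a : A) : Prop := exists k : nat, a ^ k == 0.

Definition enumerates (A : comRing) (e : nat -> A) : Prop :=
  forall a : A, exists n : nat, e n == a.

(** The first clause makes [I] a subset of the setoid [A]; closure under [opp]
    follows from closure under multiplication by [opp 1]. *)
Definition ideal (A : comRing) (I : A -> Prop) : Prop :=
  (forall a b : A, a == b -> I a -> I b) /\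
  I 0 /\
  (forall a b : A, I a -> I b -> I (a + b)) /\
  (forall r a : A, I a -> I (r * a)).

Definition prime_ideal (A : comRing) (p : A -> Prop) : Prop :=
  ideal p /\
  neg A (p 1) /\
  (forall a b : A, p (a * b) -> neg A (p a) -> p b).

Definition radical (A : comRing) (p : A -> Prop) : Prop :=
  forall (k : nat) (a : A), p (a ^ k) -> p a.

Definition negneg_stable (A : comRing) (p : A -> Prop) : Prop :=
  forall a : A, neg A (neg A (p a)) -> p a.

(* Main.v *)
(** Enumerate the ring and adjoin its elements one after the other to the zero
    ideal, the [n]-th one under the condition that the ideal obtained still
    avoids all powers of [x]. The union [m] of this chain avoids the powers of
    [x], and [a] lies in [m] iff [m + (a)] avoids them. This describes [m] by a
    negation, so [m] is negneg-stable, and the other properties follow since a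
    product of elements of [m + (a)] and [m + (b)] lies in [m + (ab)]. No stage
    requires deciding whether its condition holds. *)

Require Import Defs.
From Stdlib Require Import Ring Setoid Morphisms Arith.

Set Implicit Arguments.
Unset Strict Implicit.

Local Open Scope cring_scope.

Section Construction.

Context (A : comRing).

#[local] Existing Instance req_equiv.

#[local] Instance add_proper : Proper (@req A ==> @req A ==> @req A) (@add A).
Proof. exact (Radd_ext (req_ext A)). Qed.

#[local] Instance mul_proper : Proper (@req A ==> @req A ==> @req A) (@mul A).
Proof. exact (Rmul_ext (req_ext A)). Qed.

Add Ring A_ring : (ring_ax A) (setoid (req_equiv A) (req_ext A)).

Lemma pow_succ (a : A) (k : nat) : a ^ S k = a * a ^ k.
Proof. reflexivity. Qed.

Lemma pow_add (a : A) (j k : nat) : a ^ (j + k)%nat == a ^ j * a ^ k.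
Proof.
  induction j as [|j IH]; simpl Nat.add.
  - change (a ^ 0%nat) with (1 : A). ring.
  - rewrite !pow_succ, IH. ring.
Qed.

Lemma pow_mul (a : A) (j k : nat) : a ^ (k * j)%nat == (a ^ j) ^ k.
Proof.
  induction k as [|k IH].
  - reflexivity.
  - simpl Nat.mul. rewrite pow_add, pow_succ, IH. reflexivity.
Qed.

Definition adjoin (I : A -> Prop) (a b : A) : Prop :=
  exists i r : A, I i /\ b == i + r * a.

Lemma adjoin_mono (I J : A -> Prop) (a b : A) :
  (forall c, I c -> J c) -> adjoin I a b -> adjoin J a b.
Proof. intros HIJ (i & r & Hi & E). exists i, r. auto. Qed.

Section Ideal.

Context (I : A -> Prop) (HI : ideal I).

Lemma ideal_ext (a b : A) : a == b -> I a -> I b.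
Proof. apply HI. Qed.

Lemma ideal_zero : I 0.
Proof. apply HI. Qed.

Lemma ideal_add (a b : A) : I a -> I b -> I (a + b).
Proof. apply HI. Qed.

Lemma ideal_mul (r a : A) : I a -> I (r * a).
Proof. apply HI. Qed.

Lemma adjoin_incl (a b : A) : I b -> adjoin I a b.
Proof. intros Hb. exists b, 0. split; [exact Hb | ring]. Qed.

Lemma adjoin_self (a : A) : adjoin I a a.
Proof. exists 0, 1. split; [exact ideal_zero | ring]. Qed.

Lemma adjoin_ideal (a : A) : ideal (adjoin I a).
Proof.
  split; [|split; [|split]].
  - intros b c E (i & r & Hi & Eb). exists i, r.
    split; [exact Hi | rewrite <- E; exact Eb].
  - apply adjoin_incl, ideal_zero.
  - intros b c (i & r & Hi & Eb) (j & s & Hj & Ec). exists (i + j), (r + s).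
    split; [apply ideal_add; assumption | rewrite Eb, Ec; ring].
  - intros s b (i & r & Hi & Eb). exists (s * i), (s * r).
    split; [apply ideal_mul, Hi | rewrite Eb; ring].
Qed.

Lemma adjoin_absorb (a b : A) : I a -> adjoin I a b -> I b.
Proof.
  intros Ha (i & r & Hi & E). apply (ideal_ext (symmetry E)).
  apply ideal_add; [exact Hi | apply ideal_mul, Ha].
Qed.

Lemma adjoin_mul (a a' b b' : A) :
  adjoin I a b -> adjoin I a' b' -> adjoin I (a * a') (b * b').
Proof.
  intros (i & r & Hi & E) (j & s & Hj & E').
  (* In the expansion of [(i + r * a) * (j + s * a')] every term except [r * s * (a * a')] has a
     factor [i] or [j]. *)
  exists ((j + s * a') * i + r * a * j), (r * s). split.
  - apply ideal_add; apply ideal_mul; assumption.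
  - rewrite E, E'. ring.
Qed.

Lemma adjoin_pow (a b : A) (k : nat) : adjoin I a b -> adjoin I (a ^ k) (b ^ k).
Proof.
  intros H. induction k as [|k IH].
  - apply adjoin_self.
  - rewrite !pow_succ. apply adjoin_mul; assumption.
Qed.

End Ideal.

Definition avoids_powers (x : A) (I : A -> Prop) : Prop :=
  neg A (exists k, I (x ^ k)).

(** Saturation turns each goal of the form [I a] into the goal [1 == 0], with a power of [x] in
    [I + (a)] at hand. It then remains to produce a power of [x] in [I] itself. *)
Lemma saturated_prime (x : A) (I : A -> Prop) :
  ideal I -> avoids_powers x I ->
  (forall a, avoids_powers x (adjoin I a) -> I a) ->
  prime_ideal I /\ radical I /\ negneg_stable I /\ neg A (I x).
Proof.
  intros HI Hav Hsat. split; [split; [exact HI | split] | split; [|split]].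
  - intros H1. apply Hav. exists 0%nat. exact H1.
  - intros a b Hab Hna. apply Hsat. intros (j & Hj).
    (* As the goal is now [1 == 0], [Hna] reduces it to [I a], and saturation supplies a second
       power of [x], in [I + (a)]. The product of both powers lies in [I + (ab)], hence in [I]. *)
    apply Hna, Hsat. intros (l & Hl). apply Hav. exists (l + j)%nat.
    apply (ideal_ext HI (symmetry (pow_add x l j))).
    apply (adjoin_absorb HI Hab). apply adjoin_mul; assumption.
  - intros k a Hak. apply Hsat. intros (j & Hj). apply Hav.
    exists (k * j)%nat. apply (ideal_ext HI (symmetry (pow_mul x j k))).
    apply (adjoin_absorb HI Hak). apply adjoin_pow; assumption.
  (* Towards [1 == 0] the double negation may be stripped, and [I + (a)] is contained in [I] once
     [a] is in [I]. *)
  - intros a Hnn. apply Hsat. intros (j & Hj). apply Hnn. intros Ha.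
    apply Hav. exists j. exact (adjoin_absorb HI Ha Hj).
  - intros Hx. apply Hav. exists 1%nat.
    apply (ideal_ext HI (a := x)); [|exact Hx].
    rewrite pow_succ. change (x ^ 0%nat) with (1 : A). ring.
Qed.

Context (e : nat -> A) (x : A).

(** The condition for adjoining [e n] is a conjunct of membership, so that no case distinction
    enters the construction. *)
Fixpoint stage (n : nat) : A -> Prop :=
  match n with
  | O => fun a => a == 0
  | S n => fun a => stage n a \/
      (avoids_powers x (adjoin (stage n) (e n)) /\ adjoin (stage n) (e n) a)
  end.

Definition limit (a : A) : Prop := exists n, stage n a.

(** The condition does not mention the element: if one of two summands brings a proof of it, both
    lie in the ideal with [e n] adjoined. *)
Lemma stage_ideal (n : nat) : ideal (stage n).
Proof.
  induction n as [|n IH]; simpl.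
  - split; [|split; [|split]].
    + intros a b E Ha. rewrite <- E. exact Ha.
    + reflexivity.
    + intros a b Ha Hb. rewrite Ha, Hb. ring.
    + intros r a Ha. rewrite Ha. ring.
  - pose proof (adjoin_ideal IH (e n)) as IH'.
    split; [|split; [|split]].
    + intros a b E [Ha | [Hav Ha]].
      * left. exact (ideal_ext IH E Ha).
      * right. split; [exact Hav | exact (ideal_ext IH' E Ha)].
    + left. exact (ideal_zero IH).
    + intros a b [Ha | [Hav Ha]] [Hb | [Hav' Hb]].
      * left. apply (ideal_add IH); assumption.
      * right. split; [assumption|].
        apply (ideal_add IH'); [apply adjoin_incl|]; assumption.
      * right. split; [assumption|].
        apply (ideal_add IH'); [|apply adjoin_incl]; assumption.
      * right. split; [assumption|]. apply (ideal_add IH'); assumption.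
    + intros r a [Ha | [Hav Ha]].
      * left. apply (ideal_mul IH), Ha.
      * right. split; [exact Hav | apply (ideal_mul IH'), Ha].
Qed.

Lemma stage_le (n m : nat) (a : A) : n <= m -> stage n a -> stage m a.
Proof. induction 1; simpl; auto. Qed.

Lemma limit_ideal : ideal limit.
Proof.
  split; [|split; [|split]].
  - intros a b E (n & Ha). exists n. exact (ideal_ext (stage_ideal n) E Ha).
  - exists 0%nat. simpl. reflexivity.
  - intros a b (n & Ha) (m & Hb). exists (Nat.max n m).
    apply (ideal_add (stage_ideal _)).
    + exact (stage_le (Nat.le_max_l n m) Ha).
    + exact (stage_le (Nat.le_max_r n m) Hb).
  - intros r a (n & Ha). exists n. apply (ideal_mul (stage_ideal n)), Ha.
Qed.

Lemma stage_avoids (n : nat) : neg A (nilpotent x) -> avoids_powers x (stage n).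
Proof.
  intros Hx. induction n as [|n IH].
  (* A power of [x] in the zero ideal is exactly a witness of nilpotency. *)
  - exact Hx.
  - intros (k & [Hk | [Hav Hk]]).
    + apply IH. exists k. exact Hk.
    + apply Hav. exists k. exact Hk.
Qed.

Lemma limit_avoids : neg A (nilpotent x) -> avoids_powers x limit.
Proof.
  intros Hx (k & n & Hk). apply (stage_avoids (n := n) Hx). exists k. exact Hk.
Qed.

(** If [a] is listed at index [n], then [stage n] with [e n] adjoined lies in [limit] with [a]
    adjoined and so avoids the powers of [x]. The condition thus holds, and [e n] enters at stage
    [S n]. *)
Lemma limit_saturated (a : A) :
  enumerates e -> avoids_powers x (adjoin limit a) -> limit a.
Proof.
  intros He Hav. destruct (He a) as (n & En).
  apply (ideal_ext limit_ideal En). exists (S n). right. split.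
  - intros (k & Hk). apply Hav. exists k.
    apply (adjoin_mono (J := limit)) in Hk; [|intros c Hc; exists n; exact Hc].
    destruct Hk as (i & r & Hi & E). exists i, r.
    split; [exact Hi | rewrite <- En; exact E].
  - apply adjoin_self, stage_ideal.
Qed.

End Construction.

Theorem corollary2p2 (A : comRing) (e : nat -> A) (He : enumerates e)
    (x : A) (Hx : neg A (nilpotent x)) :
  exists p : A -> Prop,
    prime_ideal p /\ radical p /\ negneg_stable p /\ neg A (p x).
Proof.
  exists (limit e x). apply saturated_prime.
  - apply limit_ideal.
  - apply limit_avoids, Hx.
  - intros a. apply limit_saturated, He.
Qed.
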